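(* There is an absolute constant $C>0$ such that every vertex-transitive graph on $n\ge 2$ vertices has an orthonormal eigenbasis (of its adjacency matrix) consisting of real-valued functions $x$ on the vertex set $V$ with $\|x\|_{L^2(V)}=1$ and $\|x\|_{L^\infty(V)}\le C\sqrt{\log n}$.
   Context: Norms are normalized with respect to the uniform probability measure on the vertex set $V$: $\|x\|_{L^2(V)}=(\mathbb{E}_{v\in V}|x(v)|^2)^{1/2}$, $\|x\|_{L^\infty(V)}=\max_v|x(v)|$, and orthonormality refers to the inner product $\langle x,y\rangle=\mathbb{E}_{v\in V}\overline{x(v)}y(v)$. *)

(* Defs.v *)
(* Finite simple graphs are symmetric irreflexive relations on a finType V;
   functions on V are {ffun V -> R^o}, so that the library's vector space
   notions (basis_of) apply to them. *)
From HB Require Import structures.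
From mathcomp Require Import all_boot all_order all_fingroup all_algebra.
From mathcomp Require Import all_classical all_reals all_analysis.

Set Implicit Arguments.
Unset Strict Implicit.
Unset Printing Implicit Defensive.

Import Order.TTheory GRing.Theory Num.Theory.

Local Open Scope ring_scope.

Section Graphs.
Variables (V : finType) (e : rel V).

Definition simple_graph : Prop := symmetric e /\ irreflexive e.

Definition graph_automorphism (s : {perm V}) : Prop :=
  forall u v : V, e (s u) (s v) = e u v.

Definition vertex_transitive : Prop :=
  forall u v : V, exists s : {perm V}, graph_automorphism s /\ s u = v.

End Graphs.

Section Functions.
Variables (R : realType) (V : finType).

Implicit Types x y : {ffun V -> R^o}.

Definition expect (f : V -> R) : R := (\sum_(v : V) f v) / #|V|%:R.

(* The functions are real-valued, so no conjugation is needed. *)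
Definition inner x y : R := expect (fun v => (x v : R) * (y v : R)).

Definition L2norm x : R := Num.sqrt (expect (fun v => `|(x v : R)| ^+ 2)).

Definition Linfnorm x : R := \big[Num.max/0]_(v : V) `|(x v : R)|.

Definition orthonormal_family (X : seq {ffun V -> R^o}) : Prop :=
  forall i j : nat, (i < size X)%N -> (j < size X)%N ->
    inner X`_i X`_j = (i == j)%:R.

(* Rows and columns are indexed by V through its enumeration. *)
Definition adjacency_mx (e : rel V) : 'M[R]_#|V| :=
  \matrix_(i, j) (e (enum_val i) (enum_val j))%:R.

Definition colvec x : 'cV[R]_#|V| := \col_i x (enum_val i).

Definition eigenfunction (A : 'M[R]_#|V|) x : Prop :=
  x != 0 /\ exists a : R, A *m colvec x = a *: colvec x.

Definition orthonormal_eigenbasis (A : 'M[R]_#|V|)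
    (X : seq {ffun V -> R^o}) : Prop :=
  [/\ basis_of fullv X,
      orthonormal_family X
    & forall x, x \in X -> eigenfunction A x].

End Functions.

(* Main.v *)
(** A vertex-transitive graph has eigenprojections with constant diagonal, since
    they commute with the automorphisms: if P_1, ..., P_m is an orthonormal basis
    of an eigenspace then the sum of the P_j(v)^2 does not depend on v.  Rotate
    this basis by H diag(e_1, ..., e_m), where H is an orthogonal m x m matrix with
    entries O(m^(-1/2)) (the discrete Hartley transform) and the e_j are random
    signs.  Each value of a rotated function is a Rademacher sum of variance at
    most 2, hence subgaussian, and a union bound over the n^2 values shows that
    some choice of signs makes all of them O(sqrt(log n)). *)
Require Import Defs.
From HB Require Import structures.
From mathcomp Require Import all_boot all_order all_fingroup all_algebra.
From mathcomp Require Import complex.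
From mathcomp Require Import all_classical all_reals all_analysis.
From mathcomp Require Import ring lra.

Set Implicit Arguments.
Unset Strict Implicit.
Unset Printing Implicit Defensive.

Import Order.TTheory GRing.Theory Num.Theory.

Local Open Scope ring_scope.

(** * Real symmetric matrices *)

Lemma row_norm_eq0 (R : realDomainType) n (w : 'rV[R]_n) :
  ((w *m w^T) 0 0 == 0) = (w == 0).
Proof.
apply/idP/eqP => [|->]; last by rewrite mul0mx mxE.
rewrite mxE psumr_eq0 => [/allP w0|j _]; last by rewrite mxE -expr2 sqr_ge0.
apply/rowP => j; rewrite mxE; apply/eqP.
by have := w0 j (mem_index_enum _); rewrite mxE -expr2 sqrf_eq0.
Qed.

(** Take the reflection in the hyperplane orthogonal to [w = u - v]. *)
Lemma householder (R : realFieldType) n (u v : 'rV[R]_n) :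
  u *m u^T = 1%:M -> v *m v^T = 1%:M ->
  exists H : 'M[R]_n, [/\ H^T = H, H *m H = 1%:M & u *m H = v].
Proof.
move=> uu vv; have [->|uDv] := eqVneq u v.
  by exists 1%:M; rewrite trmx1 !mulmx1.
pose w := u - v; pose c := (w *m w^T) 0 0.
have c0 : c != 0 by rewrite row_norm_eq0 subr_eq0.
have ww : w *m w^T = c%:M by exact: mx11_scalar.
(* As [u] and [v] have equal length, [u] has inner product [c / 2] with [w], so the reflection
   subtracts exactly [w] from [u]. *)
have uw : u *m w^T = (c / 2)%:M.
  pose b := (u *m v^T) 0 0.
  have uv : u *m v^T = b%:M by exact: mx11_scalar.
  have vu : v *m u^T = b%:M by rewrite -[LHS]trmxK trmx_mul trmxK uv tr_scalar_mx.
  have -> : c = 2 - 2 * b.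
    have := ww; rewrite /w linearB /= mulmxBl !mulmxBr uu vv uv vu.
    by move=> /matrixP/(_ 0 0); rewrite !mxE eqxx !mulr1n; lra.
  rewrite linearB /= mulmxBr uu uv -raddfB /=; by congr (_%:M); field.
exists (1%:M - (2 / c) *: (w^T *m w)); split.
- by rewrite linearB /= trmx1 linearZ /= trmx_mul trmxK.
- have WW : w^T *m w *m (w^T *m w) = c *: (w^T *m w).
    by rewrite mulmxA -[w^T *m w *m w^T]mulmxA ww mul_mx_scalar -scalemxAl.
  move: (w^T *m w) WW => W WW.
  rewrite mulmxBl mul1mx mulmxBr mulmx1 -scalemxAl -scalemxAr WW !scalerA.
  have -> : 2 / c * (2 / c) * c = 2 / c + 2 / c by field.
  by rewrite scalerDl opprB addrK subrK.
- rewrite mulmxBr mulmx1 -scalemxAr mulmxA uw mul_scalar_mx scalerA.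
  have -> : 2 / c * (c / 2) = 1 by field.
  by rewrite scale1r /w subKr.
Qed.

(** Over the complex closure an eigenvalue [z] exists. The matrix is Hermitian there, so evaluating
    [v A v^*] in two ways gives [z = z^*]. A real root of the complex characteristic polynomial is a
    root of the real one. *)
Lemma symmetric_eigenvalue (R : rcfType) n (A : 'M[R]_n) :
  (0 < n)%N -> A^T = A -> exists a, eigenvalue A a.
Proof.
move=> n_gt0 Asym; pose AC := map_mx (real_complex R) A.
have [z Az] := eigenvalue_closed AC n_gt0.
have [v vA v0] := eigenvalueP Az.
have AC_herm : (map_mx Num.conj AC)^T = AC.
  apply/matrixP => i j; rewrite !mxE -[in RHS]Asym mxE.
  by apply/CrealP/complex_realP; exists (A j i).
have : z * (v *m (map_mx Num.conj v)^T) 0 0 =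
       z^* * (v *m (map_mx Num.conj v)^T) 0 0.
  have -> : z * (v *m (map_mx Num.conj v)^T) 0 0 =
            (v *m AC *m (map_mx Num.conj v)^T) 0 0.
    by rewrite vA -scalemxAl [in RHS]mxE.
  rewrite -mulmxA -{1}AC_herm -trmx_mul -map_mxM vA.
  by rewrite map_mxZ linearZ /= -scalemxAr [in LHS]mxE.
move=> /mulIf zz.
have /complex_realP[a za] : z \is Num.real.
  apply/CrealP/esym/zz; rewrite mxE psumr_neq0; last first.
    by move=> j _; rewrite !mxE mul_conjC_ge0.
  have /rV0Pn[j vj] := v0; apply/hasP; exists j; first exact: mem_index_enum.
  by rewrite !mxE mul_conjC_gt0.
exists a; move: Az; rewrite za !eigenvalue_root_char.
by rewrite -map_char_poly fmorph_root.
Qed.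

Lemma symmetric_unit_eigenvector (R : rcfType) n (A : 'M[R]_n) :
  (0 < n)%N -> A^T = A ->
  exists a (v : 'rV[R]_n), v *m v^T = 1%:M /\ v *m A = a *: v.
Proof.
move=> n_gt0 /(symmetric_eigenvalue n_gt0)[a /eigenvalueP[v vA v0]].
pose c := (v *m v^T) 0 0.
have c_gt0 : 0 < c.
  rewrite lt0r row_norm_eq0 v0 /c mxE.
  by apply: sumr_ge0 => j _; rewrite mxE -expr2 sqr_ge0.
exists a, ((Num.sqrt c)^-1 *: v); split; last first.
  by rewrite -scalemxAl vA !scalerA mulrC.
rewrite linearZ /= -scalemxAl -scalemxAr scalerA [v *m _]mx11_scalar -/c.
by rewrite scale_scalar_mx -expr2 exprVn sqr_sqrtr ?ltW// mulVf ?gt_eqF.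
Qed.

(* Deflation: a reflection moves a unit eigenvector to the first basis vector. *)
Lemma real_spectral (R : rcfType) n (A : 'M[R]_n) : A^T = A ->
  exists (P : 'M[R]_n) (d : 'rV[R]_n),
    P *m P^T = 1%:M /\ P *m A = diag_mx d *m P.
Proof.
elim: n A => [|n IHn] A Asym; first by exists 0, 0; split; apply/matrixP => -[].
have [a [v [vv vA]]] := @symmetric_unit_eigenvector _ n.+1 A isT Asym.
pose e0 : 'rV[R]_(1 + n) := row_mx 1%:M 0.
have e0e0 : e0 *m e0^T = 1%:M.
  by rewrite tr_row_mx mul_row_col trmx1 trmx0 mulmx1 mulmx0 addr0.
have [H [Hsym HH e0H]] := householder e0e0 vv.
pose B : 'M[R]_(1 + n) := H *m A *m H.
have Bsym : B^T = B by rewrite !trmx_mul Asym Hsym mulmxA.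
have e0B : e0 *m B = a *: e0.
  by rewrite !mulmxA e0H vA -scalemxAl -e0H -mulmxA HH mulmx1.
have := e0B; rewrite -{1}[B]submxK mul_row_block !mul1mx !mul0mx !addr0.
rewrite scale_row_mx scaler0 => /eq_row_mx[Bul Bur].
(* The first row of [B] is [(a, 0)], and symmetry clears the first column too, which leaves a
   symmetric block of order [n]. *)
have Bdl : dlsubmx B = 0.
  by rewrite -[dlsubmx B]trmxK trmx_dlsub Bsym Bur trmx0.
have [|P' [d' [PP' PB']]] := IHn (drsubmx B); first by rewrite trmx_drsub Bsym.
pose L : 'M[R]_(1 + n) := block_mx 1%:M 0 0 P'.
have LL : L *m L^T = 1%:M.
  rewrite /L tr_block_mx mulmx_block !trmx0 trmx1 !(mulmx0, mul0mx, addr0, add0r).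
  by rewrite mulmx1 PP' -scalar_mx_block.
have LB : L *m B = diag_mx (row_mx a%:M d') *m L.
  rewrite -{1}[B]submxK diag_mx_row Bur Bul Bdl /L !mulmx_block.
  rewrite !(mulmx0, mul0mx, addr0, add0r) PB' mul1mx mulmx1.
  congr block_mx; apply/matrixP => i j; rewrite !ord1 !mxE eqxx mulr1n.
  by rewrite mulr1.
exists (L *m H), (row_mx a%:M d'); split.
  by rewrite trmx_mul Hsym mulmxA -[L *m H *m H]mulmxA HH mulmx1.
rewrite mulmxA -LB /B mulmxA mulmxA -!mulmxA; congr (_ *m _).
by rewrite HH mulmx1.
Qed.

(** * The discrete Hartley transform *)

Section Hartley.
Variable R : realType.
Implicit Types (x : R) (m j k l : nat).

Lemma cos_sin_nat2pi k :
  cos (k%:R * (pi *+ 2)) = 1 :> R /\ sin (k%:R * (pi *+ 2)) = 0 :> R.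
Proof.
elim: k => [|k [IHc IHs]]; first by rewrite mul0r cos0 sin0.
rewrite -natr1 mulrDl mul1r (cosD (_ * _)) (sinD (_ * _)) cos2pi sin2pi IHc IHs.
by split; ring.
Qed.

(* Shifting the index rotates the vector (sum of cosines, sum of sines) by the
   angle x while leaving it unchanged. *)
Lemma trig_sums_shift m x : cos (m%:R * x) = 1 -> sin (m%:R * x) = 0 ->
  let Sc := \sum_(k < m) cos (k%:R * x) in
  let Ss := \sum_(k < m) sin (k%:R * x) in
  Sc = cos x * Sc - sin x * Ss /\ Ss = sin x * Sc + cos x * Ss.
Proof.
move=> cm sm Sc Ss.
(* With the common end value added, both sums become the sum over [m.+1] indices, split off at the
   last or at the first term. *)
have shift (f : R -> R) : f (m%:R * x) = f 0 ->
    \sum_(k < m) f (k%:R * x) = \sum_(k < m) f (k%:R * x + x).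
  move=> fm; apply: (@addIr _ (f 0)); rewrite -{1}fm.
  transitivity (\sum_(k < m.+1) f (k%:R * x)); first by rewrite big_ord_recr.
  rewrite big_ord_recl mul0r addrC; congr (_ + _); apply: eq_bigr => k _.
  by rewrite lift0 -natr1 mulrDl mul1r.
split.
- rewrite {1}/Sc shift ?cm ?cos0// !mulr_sumr -sumrB.
  by apply: eq_bigr => k _; rewrite cosD; ring.
- rewrite {1}/Ss shift ?sm ?sin0// !mulr_sumr -big_split /=.
  by apply: eq_bigr => k _; rewrite sinD; ring.
Qed.

(** A nontrivial rotation fixes only the zero vector; the combination below eliminates the sine
    sum. *)
Lemma sum_cos_eq0 m x : cos (m%:R * x) = 1 -> sin (m%:R * x) = 0 ->
  cos x != 1 -> \sum_(k < m) cos (k%:R * x) = 0.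
Proof.
move=> cm sm cx; have [] := trig_sums_shift cm sm.
set Sc := \sum_(k < m) cos _; set Ss := \sum_(k < m) sin _ => eqc eqs.
have eq0 : (1 - cos x) * (2 * Sc) = 0.
  have -> : (1 - cos x) * (2 * Sc) = (1 - cos x) * (Sc - (cos x * Sc - sin x * Ss))
     - sin x * (Ss - (sin x * Sc + cos x * Ss))
     + (1 - (cos x ^+ 2 + sin x ^+ 2)) * Sc by ring.
  by rewrite -eqc -eqs cos2Dsin2 !subrr !mulr0 mul0r subrr addr0.
move/eqP: eq0; rewrite !mulf_eq0 subr_eq0 eq_sym (negPf cx) pnatr_eq0 /=.
by move/eqP.
Qed.

(** If [cos x = 1], every term vanishes; otherwise the cosine sum is zero and the second shift
    relation leaves [(1 - cos x) Ss = 0]. *)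
Lemma sum_sin_eq0 m x : cos (m%:R * x) = 1 -> sin (m%:R * x) = 0 ->
  \sum_(k < m) sin (k%:R * x) = 0.
Proof.
move=> cm sm; have [cx|cx] := eqVneq (cos x) 1.
  have sx : sin x = 0 by apply: cos1sin0; rewrite cx normr1.
  rewrite big1 // => k _; elim: (k : nat) => [|{}k IHk].
    by rewrite mul0r sin0.
  by rewrite -natr1 mulrDl mul1r sinD sx IHk mul0r mulr0 addr0.
have [_] := trig_sums_shift cm sm.
by rewrite (sum_cos_eq0 cm sm cx) mulr0 add0r => /eqP;
  rewrite -subr_eq0 -{1}[X in X - _]mul1r -mulrBl mulf_eq0 subr_eq0 eq_sym
    (negPf cx) => /eqP.
Qed.

(* Real, with flat entries, and orthogonal for every order m > 0. *)
Definition hartley m j k : R :=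
  let t := k%:R * (j%:R * (pi *+ 2 / m%:R)) in
  (cos t + sin t) / Num.sqrt m%:R.

Lemma hartley_sqr_le m j k : hartley m j k ^+ 2 <= 2 / m%:R.
Proof.
rewrite /hartley; set t := k%:R * _.
rewrite exprMn exprVn sqr_sqrtr ?ler0n// ler_wpM2r ?invr_ge0 ?ler0n//.
have cs1 := cos2Dsin2 t; have cs0 := sqr_ge0 (cos t - sin t); lra.
Qed.

(** The product of [cos a + sin a] and [cos b + sin b] is [cos (a - b) + sin (a + b)], and both
    terms are summed over full periods. *)
Lemma hartley_orthonormal m j l : (j < m)%N -> (l < m)%N ->
  \sum_(k < m) hartley m j k * hartley m l k = (j == l)%:R.
Proof.
(* This makes the truncated subtraction [j - l] a true difference. *)
wlog lj : j l / (l <= j)%N.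
  move=> wl jm lm; have [lj|/ltnW jl] := leqP l j; first exact: wl.
  rewrite eq_sym -wl//; apply: eq_bigr => k _; exact: mulrC.
move=> jm lm; have m_gt0 : (0 < m)%N by apply: leq_ltn_trans jm.
have m0 : (m%:R : R) != 0 by rewrite pnatr_eq0 -lt0n.
pose w : R := pi *+ 2 / m%:R.
have period p : cos (m%:R * (p%:R * w)) = 1 /\ sin (m%:R * (p%:R * w)) = 0.
  have -> : m%:R * (p%:R * w) = p%:R * (pi *+ 2) by rewrite /w; field.
  exact: cos_sin_nat2pi.
transitivity ((\sum_(k < m) cos (k%:R * ((j - l)%:R * w)) +
   \sum_(k < m) sin (k%:R * ((j + l)%:R * w))) / m%:R).
  rewrite -big_split /= mulr_suml; apply: eq_bigr => k _.
  rewrite /hartley -/w mulrACA -invfM -expr2 sqr_sqrtr ?ler0n//; congr (_ / _).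
  have -> : k%:R * ((j - l)%:R * w) = k%:R * (j%:R * w) - k%:R * (l%:R * w).
    by rewrite natrB//; ring.
  have -> : k%:R * ((j + l)%:R * w) = k%:R * (j%:R * w) + k%:R * (l%:R * w).
    by rewrite natrD; ring.
  by rewrite cosB sinD; ring.
have [cs ss] := period (j + l)%N; rewrite (sum_sin_eq0 cs ss) addr0.
have [->|jDl] := eqVneq j l.
  rewrite subnn; under eq_bigr do rewrite mul0r mulr0 cos0.
  by rewrite sumr_const card_ord mulfV.
have [cd sd] := period (j - l)%N; rewrite (sum_cos_eq0 cd sd) ?mul0r//.
(* The half angle lies strictly between 0 and [pi], so its sine is positive and
   [cos (2 y) = 1 - 2 sin^2 y] differs from 1. *)
pose y : R := (j - l)%:R * (pi / m%:R).
have -> : (j - l)%:R * w = y *+ 2 by rewrite /y /w; field.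
rewrite cos_mulr2n cos2sin2.
have y_gt0 : 0 < y.
  by rewrite mulr_gt0 ?divr_gt0 ?pi_gt0 ?ltr0n// subn_gt0 ltn_neqAle eq_sym jDl.
have y_ltpi : y < pi.
  rewrite /y mulrCA gtr_pMr ?pi_gt0// ltr_pdivrMr ?ltr0n// mul1r ltr_nat.
  exact: leq_ltn_trans (leq_subr _ _) jm.
have : 0 < sin y by apply: sin_gt0_pi; rewrite y_gt0.
by move/(exprn_gt0 2) => s2; apply/eqP; lra.
Qed.

End Hartley.

(** * Rademacher sums *)

Section Signs.
Variable R : realType.

(** Subgaussian bound for one random sign. The constant 2 in the exponent is not sharp, but lets
    [1 + x <= expR x] suffice for small [x]. *)
Lemma expRDN_le (x : R) : expR x + expR (- x) <= 2 * expR (2 * x ^+ 2).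
Proof.
(* From [|x| = 1/2] on, [|x| <= 2 x^2] and each exponential is bounded separately. *)
have [x_small|x_big] := leP (x ^+ 2) 4^-1.
  have [x1 x2] : x < 1 /\ -1 < x by split; nra.
  have e1 : expR x <= (1 - x)^-1.
    by rewrite -[leLHS]invrK lef_pV2 ?posrE ?invr_gt0 ?expR_gt0 ?subr_gt0//
      -expRN expR_ge1Dx.
  have e2 : expR (- x) <= (1 + x)^-1.
    rewrite expRN lef_pV2 ?posrE ?expR_gt0 ?expR_ge1Dx//; lra.
  have e3 := expR_ge1Dx (2 * x ^+ 2).
  apply: le_trans (lerD e1 e2) _.
  apply: (@le_trans _ _ (2 * (1 + 2 * x ^+ 2))); last by lra.
  have -> : (1 - x)^-1 + (1 + x)^-1 = 2 / (1 - x ^+ 2).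
    by field; rewrite ?gt_eqF//; nra.
  rewrite ler_pdivrMr; nra.
have le_exp y : y ^+ 2 = x ^+ 2 -> expR y <= expR (2 * x ^+ 2).
  by move=> yx; rewrite ler_expR; nra.
by have := le_exp x erefl; have := le_exp (- x) (sqrrN x); lra.
Qed.

Lemma sum_le_card_exists (T : finType) (f : T -> R) (c : R) (t0 : T) :
  \sum_t f t <= #|T|%:R * c -> exists t, f t <= c.
Proof.
move=> le_f; apply/existsP; apply: contraLR le_f => /existsPn no.
rewrite -ltNge mulr_natl -sumr_const; apply: ltr_sum => [|t _].
  by apply/hasP; exists t0; first exact: mem_index_enum.
by rewrite ltNge no.
Qed.

(* Averaging the exponential moment over all sign vectors. *)
Lemma exists_signs_expR (J K : finType) (g : K -> J -> R) :
  exists e : {ffun J -> bool},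
    \sum_k expR (\sum_j (-1) ^+ (e j) * g k j) <=
    \sum_k expR (2 * \sum_j g k j ^+ 2).
Proof.
apply: (@sum_le_card_exists _ _ _ [ffun => false]).
rewrite exchange_big mulr_sumr /=; apply: ler_sum => k _.
under eq_bigr do rewrite expR_sum.
(* Independence of the signs: the sum over all sign vectors factors over the coordinates. *)
rewrite -(bigA_distr_bigA (fun j (b : bool) => expR ((-1) ^+ b * g k j))) /=.
rewrite card_ffun card_bool natrX -prodr_const mulr_sumr expR_sum -big_split /=.
apply: ler_prod => j _; rewrite big_bool /= expr1 expr0 mul1r mulN1r addrC.
by rewrite addr_ge0 ?expR_ge0//= expRDN_le.
Qed.

(** Chernoff's method with parameter [t]: one exponential is at most the sum of all of them, and
    logarithms are taken. *)
Lemma exists_signs_bound (J K : finType) (g : K -> J -> R) (s t : R) :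
  0 <= t -> (forall k, \sum_j g k j ^+ 2 <= s) ->
  exists e : {ffun J -> bool}, forall k,
    t * `|\sum_j (-1) ^+ (e j) * g k j| <= ln (2 * #|K|%:R) + 2 * (t ^+ 2 * s).
Proof.
move=> t_ge0 g_s.
(* The extra boolean covers both tails, whence the factor 2 in front of [#|K|]. *)
pose g2 (kb : K * bool) j := (-1) ^+ kb.2 * t * g kb.1 j.
have [e e_le] := exists_signs_expR g2; exists e => k.
set S := \sum_j _.
have [b Sb] : exists b : bool, `|S| = (-1) ^+ b * S.
  have [S0|S0] := leP 0 S; first by exists false; rewrite mul1r ger0_norm.
  by exists true; rewrite mulN1r ltr0_norm.
have K_gt0 : (0 < #|K|)%N by rewrite (cardD1 k).
have N_gt0 : (0 : R) < 2 * #|K|%:R by rewrite mulr_gt0 ?ltr0n.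
rewrite -ler_expR expRD lnK ?posrE//.
have -> : t * `|S| = \sum_j (-1) ^+ e j * g2 (k, b) j.
  by rewrite Sb mulrA !mulr_sumr; apply: eq_bigr => j _; rewrite /g2 /=; ring.
apply: le_trans (_ : \sum_kb expR (\sum_j (-1) ^+ e j * g2 kb j) <= _).
  by rewrite (bigD1 (k, b)) //= lerDl sumr_ge0// => kb _; exact: expR_ge0.
apply: le_trans e_le _.
have -> : 2 * #|K|%:R = #|{: K * bool}|%:R :> R.
  by rewrite card_prod card_bool natrM mulrC.
rewrite mulr_natl -sumr_const; apply: ler_sum => kb _; rewrite ler_expR.
rewrite ler_pM2l//; under eq_bigr do rewrite /g2 exprMn exprMn sqrr_sign mul1r.
by rewrite -mulr_sumr ler_wpM2l ?sqr_ge0.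
Qed.

End Signs.

(** * Flat eigenbases of transitive matrices *)

Section TransitiveMatrix.
Variables (R : realFieldType) (n : nat).
Implicit Types (A B P : 'M[R]_n) (d : 'rV[R]_n) (s : 'S_n).

Definition mx_invariant A s := forall i j, A (s i) (s j) = A i j.

Definition mx_transitive A :=
  forall i j, exists2 s : 'S_n, mx_invariant A s & s i = j.

Lemma mx_invariantP A s :
  mx_invariant A s <-> perm_mx s *m A = A *m perm_mx s.
Proof.
have -> : A *m perm_mx s = col_perm s^-1 A by rewrite col_permE invgK.
rewrite -row_permE; split => [Ainv|Acomm i j].
  by apply/matrixP => i j; rewrite !mxE -{1}[j](permKV s) Ainv.
by have /matrixP/(_ i (s j)) := Acomm; rewrite !mxE permK.
Qed.

(** For orthogonal [P] diagonalising [A], this is the orthogonal projection onto the eigenspace of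
    [a]. *)
Definition eigenproj P d (a : R) : 'M[R]_n :=
  P^T *m diag_mx (\row_i (d 0 i == a)%:R) *m P.

(** In the eigenbasis [B] becomes [B'], which commutes with [diag_mx d]: its entries between
    distinct eigenvalues vanish, so it also commutes with the indicator matrix [F]. *)
Lemma eigenproj_comm A B P d a :
  P *m P^T = 1%:M -> P *m A = diag_mx d *m P ->
  B *m A = A *m B -> B *m eigenproj P d a = eigenproj P d a *m B.
Proof.
move=> PPt PA BA; have PtP := mulmx1C PPt.
have APt : A *m P^T = P^T *m diag_mx d.
  by rewrite -[LHS]mul1mx -PtP -mulmxA [P *m _]mulmxA PA -!mulmxA PPt mulmx1.
pose B' := P *m B *m P^T.
have B'd : B' *m diag_mx d = diag_mx d *m B'.
  by rewrite /B' -mulmxA -APt !mulmxA -[P *m B *m A]mulmxA BA !mulmxA PA.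
pose F : 'M[R]_n := diag_mx (\row_i (d 0 i == a)%:R).
have B'F : B' *m F = F *m B'.
  apply/matrixP => i j; have /matrixP/(_ i j) := B'd.
  rewrite !mul_mx_diag !mul_diag_mx !mxE => /eqP.
  rewrite mulrC -subr_eq0 -mulrBl mulf_eq0 subr_eq0 => /orP[]/eqP->.
    by rewrite mulrC.
  by rewrite mul0r mulr0.
have -> : B = P^T *m B' *m P by rewrite /B' !mulmxA PtP mul1mx -mulmxA PtP mulmx1.
move: B' B'F {B'd} => B' B'F.
rewrite /eigenproj -/F -!mulmxA; congr (P^T *m _).
by rewrite !mulmxA -[B' *m P *m _]mulmxA -[F *m P *m _]mulmxA PPt !mulmx1 B'F.
Qed.

Lemma eigenproj_diagE P d a v :
  eigenproj P d a v v = \sum_(j | d 0 j == a) P j v ^+ 2.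
Proof.
rewrite /eigenproj mul_mx_diag !mxE [RHS]big_mkcond; apply: eq_bigr => j _.
by rewrite !mxE; case: eqP; rewrite ?mulr1 ?mulr0 ?mul0r// expr2.
Qed.

(** The projection has constant diagonal by transitivity, and its trace counts the rows of [P] with
    eigenvalue [a]. *)
Lemma transitive_eigenproj_diag A P d a v :
  mx_transitive A -> P *m P^T = 1%:M -> P *m A = diag_mx d *m P ->
  \sum_(j | d 0 j == a) P j v ^+ 2 = #|[set j | d 0 j == a]|%:R / n%:R.
Proof.
move=> Atr PPt PA.
have Ediag u : eigenproj P d a u u = eigenproj P d a v v.
  have [s /mx_invariantP/(eigenproj_comm a PPt PA)/mx_invariantP Es sv] := Atr v u.
  by rewrite -[RHS]Es sv.
have n0 : (n%:R : R) != 0 by rewrite pnatr_eq0 -lt0n (leq_ltn_trans _ (ltn_ord v)).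
rewrite -eigenproj_diagE; apply: (mulfI n0); rewrite mulrCA mulfV// mulr1.
transitivity (\sum_u eigenproj P d a u u).
  by under eq_bigr do rewrite Ediag; rewrite sumr_const card_ord mulr_natl.
under eq_bigr do rewrite eigenproj_diagE.
rewrite exchange_big /= -sum1_card natr_sum.
under [RHS]eq_bigl do rewrite inE.
apply: eq_bigr => j _; have /matrixP/(_ j j) := PPt; rewrite !mxE eqxx => <-.
by apply: eq_bigr => u _; rewrite mxE expr2.
Qed.

End TransitiveMatrix.

Lemma sum_index_enum (T : finType) (V : nmodType) (A : {set T}) (F : nat -> V) :
  \sum_(x in A) F (index x (enum A)) = \sum_(k < #|A|) F k.
Proof.
rewrite -big_enum cardE /=; case E : (enum A) => [|x0 s].
  by rewrite big_nil big_ord0.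
rewrite (big_nth x0) big_mkord; apply: eq_bigr => k _.
by rewrite index_uniq// -E enum_uniq.
Qed.

Section FlatEigenbasis.
Variables (R : realType) (n : nat) (d : 'rV[R]_n).

Let cls (i : 'I_n) := [set k | d 0 k == d 0 i].

Let rk (i : 'I_n) := index i (enum (cls i)).

(** One Hartley block per eigenvalue. Equal entries of [d] need not be adjacent, so [rk] numbers the
    indices inside each class. *)
Definition block_hartley : 'M[R]_n :=
  \matrix_(i, j) if d 0 j == d 0 i then hartley R #|cls i| (rk i) (rk j) else 0.

Definition signed_hartley (e : 'I_n -> bool) : 'M[R]_n :=
  \matrix_(i, j) (block_hartley i j * (-1) ^+ e j).

Let cls_eq i j : d 0 j = d 0 i -> cls j = cls i.
Proof. by move=> dji; rewrite /cls dji. Qed.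

Let rk_lt i : (rk i < #|cls i|)%N.
Proof. by rewrite cardE index_mem mem_enum inE. Qed.

(** The signs square to 1; rows of different classes have disjoint supports, and within a class the
    Hartley rows are orthonormal. *)
Lemma signed_hartley_orthogonal e :
  signed_hartley e *m (signed_hartley e)^T = 1%:M.
Proof.
apply/matrixP => i l; rewrite !mxE.
transitivity (\sum_j block_hartley i j * block_hartley l j).
  by apply: eq_bigr => j _; rewrite !mxE mulrACA -expr2 sqrr_sign mulr1.
have [dli|dli] := eqVneq (d 0 l) (d 0 i); last first.
  rewrite big1 => [|j _]; first by have [il|//] := eqVneq i l; rewrite il eqxx in dli.
  rewrite !mxE; case: eqP => [->|]; last by rewrite mul0r.
  by rewrite eq_sym (negPf dli) mulr0.
have cli := cls_eq dli.
transitivity (\sum_(j in cls i) hartley R #|cls i| (rk i) (index j (enum (cls i)))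
   * hartley R #|cls i| (rk l) (index j (enum (cls i)))).
  rewrite [RHS]big_mkcond; apply: eq_bigr => j _; rewrite !mxE inE dli cli.
  case: eqP => [dji|_]; last by rewrite mulr0.
  by rewrite /rk (cls_eq dji).
rewrite (sum_index_enum (cls i)
  (fun k => hartley R #|cls i| (rk i) k * hartley R #|cls i| (rk l) k)).
rewrite hartley_orthonormal ?rk_lt// -?cli ?rk_lt//; congr (_%:R).
congr nat_of_bool; apply/eqP/eqP => [|->//].
by rewrite /rk cli => /index_inj->//; rewrite mem_enum inE ?dli.
Qed.

Lemma signed_hartley_diag e :
  signed_hartley e *m diag_mx d = diag_mx d *m signed_hartley e.
Proof.
apply/matrixP => i j; rewrite mul_mx_diag mul_diag_mx !mxE.
by case: eqP => [->|_]; [exact: mulrC | rewrite !mul0r mulr0].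
Qed.

Lemma block_hartley_sum_le (c : 'I_n -> R) i :
  \sum_j (block_hartley i j * c j) ^+ 2 <=
  2 / #|cls i|%:R * \sum_(j | d 0 j == d 0 i) c j ^+ 2.
Proof.
rewrite mulr_sumr [leRHS]big_mkcond; apply: ler_sum => j _; rewrite mxE exprMn.
case: eqP => _; last by rewrite expr0n mul0r.
by rewrite ler_wpM2r ?sqr_ge0 ?hartley_sqr_le.
Qed.

Lemma flat_eigenbasis (A P : 'M[R]_n) :
  (1 < n)%N -> mx_transitive A ->
  P *m P^T = 1%:M -> P *m A = diag_mx d *m P ->
  exists Q : 'M[R]_n, [/\ Q *m Q^T = 1%:M, Q *m A = diag_mx d *m Q
    & forall i v, `|Num.sqrt n%:R * Q i v| <= 7 * Num.sqrt (ln n%:R)].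
Proof.
move=> n_gt1 Atr PPt PA.
have n_gt0 : (0 : R) < n%:R by rewrite ltr0n ltnW.
pose g (iv : 'I_n * 'I_n) (j : 'I_n) :=
  Num.sqrt n%:R * (block_hartley iv.1 j * P j iv.2).
(* For a class of size [m] the variance is at most [n * (2 / m) * (m / n) = 2]. *)
have g_le iv : \sum_j g iv j ^+ 2 <= 2.
  case: iv => i v; under eq_bigr do rewrite /g exprMn sqr_sqrtr ?ler0n//=.
  rewrite -mulr_sumr; apply: le_trans (ler_wpM2l (ltW n_gt0)
    (block_hartley_sum_le (fun j => P j v) i)) _.
  rewrite (transitive_eigenproj_diag _ _ Atr PPt PA).
  have cls_gt0 : (0 : R) < #|cls i|%:R.
    by rewrite ltr0n (leq_ltn_trans (leq0n _) (rk_lt i)).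
  by rewrite -/(cls i) le_eqVlt; apply/orP; left; apply/eqP; field;
    rewrite ?gt_eqF.
pose lam := Num.sqrt (ln n%:R : R).
have ln_gt0 : 0 < ln n%:R :> R by rewrite ln_gt0// ltr1n.
have lam_gt0 : 0 < lam by rewrite sqrtr_gt0.
have lam2 : lam ^+ 2 = ln n%:R by rewrite sqr_sqrtr ?ltW.
have [e e_le] := exists_signs_bound (ltW lam_gt0) g_le.
exists (signed_hartley e *m P); split.
- rewrite trmx_mul mulmxA -[_ *m P *m P^T]mulmxA PPt mulmx1.
  exact: signed_hartley_orthogonal.
- by rewrite -mulmxA PA !mulmxA signed_hartley_diag.
move=> i v; have := e_le (i, v).
have -> : \sum_j (-1) ^+ e j * g (i, v) j =
    Num.sqrt n%:R * (signed_hartley e *m P) i v.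
  rewrite [in RHS]mxE mulr_sumr; apply: eq_bigr => j _.
  by rewrite [signed_hartley e i j]mxE /g /=; ring.
rewrite -/lam lam2 card_prod card_ord => le_lam.
rewrite -(ler_pM2l lam_gt0) (le_trans le_lam)//.
(* The 3 pays for the union bound, since [2 n^2 <= n^3] for [n >= 2]; the other 4 is [2 t^2 s] with
   [t = lam] and [s = 2]. *)
have -> : lam * (7 * lam) = 3 * ln n%:R + 2 * (ln n%:R * 2).
  by rewrite -lam2; ring.
rewrite lerD2r [leRHS]mulr_natl -lnXn// ler_ln ?posrE ?exprn_gt0//; last first.
  by rewrite mulr_gt0// ltr0n muln_gt0 ltnW.
by rewrite natrM !exprS expr0 mulr1 ler_pM2r ?mulr_gt0// ler_nat.
Qed.

End FlatEigenbasis.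

(** * Functions on the vertex set *)

Section MatrixFunctions.
Variables (R : realType) (V : finType).
Implicit Types (A Q : 'M[R]_#|V|) (d : 'rV[R]_#|V|) (X : seq {ffun V -> R^o}).

Lemma L2norm_inner (x : {ffun V -> R^o}) : L2norm x = Num.sqrt (inner x x).
Proof.
rewrite /L2norm /inner /expect; congr (Num.sqrt (_ / _)).
by apply: eq_bigr => v _; rewrite real_normK ?num_real// expr2.
Qed.

Lemma inner_suml n (k : 'I_n -> R) (x : 'I_n -> {ffun V -> R^o}) y :
  inner (\sum_i k i *: x i) y = \sum_i k i * inner (x i) y.
Proof.
rewrite /inner /expect.
under [RHS]eq_bigr do rewrite mulrA.
rewrite -mulr_suml; congr (_ / _).
under [RHS]eq_bigr do rewrite mulr_sumr.
rewrite exchange_big /=; apply: eq_bigr => v _.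
rewrite sum_ffunE mulr_suml; apply: eq_bigr => i _.
by rewrite ffunE /GRing.scale /= mulrA.
Qed.

Lemma orthonormal_free X : orthonormal_family X -> free X.
Proof.
move=> Xo; apply/(@freeP _ _ _ (in_tuple X)) => k kX0 i.
have : inner (\sum_(j < size X) k j *: X`_j) X`_i = 0.
  by rewrite kX0 /inner /expect big1 ?mul0r// => v _; rewrite ffunE mul0r.
rewrite inner_suml (bigD1 i) //= Xo// eqxx mulr1 big1 ?addr0// => j ji.
by rewrite Xo// (negPf (ji : j != i :> nat)) mulr0.
Qed.

Lemma orthonormal_basis X :
  orthonormal_family X -> size X = #|V| -> basis_of fullv X.
Proof.
move=> /orthonormal_free Xf sX; rewrite basisEfree Xf subvf sX dimvf.
by rewrite /dim /= muln1.
Qed.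

(** The factor turns Euclidean unit rows into unit vectors for the uniform probability measure. *)
Definition row_fun Q (i : 'I_#|V|) : {ffun V -> R^o} :=
  [ffun v => Num.sqrt #|V|%:R * Q i (enum_rank v)].

Lemma inner_row_fun Q i j : (0 < #|V|)%N ->
  inner (row_fun Q i) (row_fun Q j) = (Q *m Q^T) i j.
Proof.
move=> V_gt0; have V0 : (#|V|%:R : R) != 0 by rewrite pnatr_eq0 -lt0n.
rewrite /inner /expect mxE.
apply: (mulIf V0); rewrite mulfVK// mulr_suml big_enum_val /=.
apply: eq_bigr => k _; rewrite !ffunE !mxE enum_valK mulrACA -expr2.
by rewrite sqr_sqrtr ?ler0n// mulrC.
Qed.

(** Rows of [Q] are left eigenvectors; symmetry of [A] makes their transposes right eigenvectors. *)
Lemma row_fun_eigen A Q d i : A^T = A -> Q *m A = diag_mx d *m Q ->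
  A *m colvec (row_fun Q i) = d 0 i *: colvec (row_fun Q i).
Proof.
move=> Asym QA.
have -> : colvec (row_fun Q i) = Num.sqrt #|V|%:R *: (row i Q)^T.
  by apply/colP => k; rewrite !mxE ffunE enum_valK.
rewrite -scalemxAr -{1}Asym -trmx_mul -row_mul QA scalerA mulrC -scalerA.
congr (_ *: _); apply/colP => k.
by rewrite mxE mxE mul_diag_mx !mxE.
Qed.

Lemma eigenbasis_of_orthogonal_mx A Q d :
  (0 < #|V|)%N -> A^T = A -> Q *m Q^T = 1%:M -> Q *m A = diag_mx d *m Q ->
  orthonormal_eigenbasis A (codom (row_fun Q)).
Proof.
move=> V_gt0 Asym QQ QA.
have sX : size (codom (row_fun Q)) = #|V| by rewrite size_codom card_ord.
have nthX (i : 'I_#|V|) : (codom (row_fun Q))`_i = row_fun Q i.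
  rewrite (nth_map i) ?size_enum_ord//; congr (row_fun Q _).
  by rewrite nth_ord_enum.
have Xo : orthonormal_family (codom (row_fun Q)).
  move=> i j; rewrite sX => iV jV.
  by rewrite (nthX (Ordinal iV)) (nthX (Ordinal jV)) inner_row_fun// QQ mxE.
split=> //; first exact: orthonormal_basis.
move=> _ /codomP[i ->]; split; last by exists (d 0 i); exact: row_fun_eigen.
apply/eqP => x0; have := inner_row_fun Q i i V_gt0.
rewrite QQ mxE eqxx x0 /inner /expect big1 => [|v _]; last by rewrite ffunE mul0r.
by rewrite mul0r => /esym/eqP; rewrite oner_eq0.
Qed.

Lemma vertex_transitive_mx (e : rel V) :
  vertex_transitive e -> mx_transitive (adjacency_mx R e).
Proof.
move=> Vtr i j; have [s [sE sij]] := Vtr (enum_val i) (enum_val j).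
have rho_inj : injective (fun k : 'I_#|V| => enum_rank (s (enum_val k))).
  by move=> k l /enum_rank_inj/perm_inj/enum_val_inj.
exists (perm rho_inj); last by rewrite permE sij enum_valK.
by move=> k l; rewrite !mxE !permE !enum_rankK sE.
Qed.

Lemma adjacency_mx_sym (e : rel V) :
  symmetric e -> (adjacency_mx R e)^T = adjacency_mx R e.
Proof. by move=> esym; apply/matrixP => i j; rewrite !mxE esym. Qed.

End MatrixFunctions.

Theorem theorem1p4 (R : realType) :
  exists C : R, 0 < C /\
    forall (V : finType) (e : rel V),
      simple_graph e -> vertex_transitive e -> (2 <= #|V|)%N ->
      exists X : seq {ffun V -> R^o},
        orthonormal_eigenbasis (adjacency_mx R e) X /\
        (forall x : {ffun V -> R^o}, x \in X ->
           L2norm x = 1 /\ Linfnorm x <= C * Num.sqrt (ln (#|V|%:R : R))).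
Proof.
exists 7; split=> // V e [esym _] Vtr V_gt1.
have V_gt0 : (0 < #|V|)%N by exact: ltnW.
have Asym := adjacency_mx_sym R esym.
have [P [d [PP PA]]] := real_spectral Asym.
have [Q [QQ QA Qle]] :=
  flat_eigenbasis V_gt1 (vertex_transitive_mx R Vtr) PP PA.
exists (codom (row_fun Q)); split; first exact: eigenbasis_of_orthogonal_mx QA.
move=> _ /codomP[i ->]; split.
  by rewrite L2norm_inner inner_row_fun// QQ mxE eqxx sqrtr1.
(* The maximum starts from 0, so the bound itself must be nonnegative. *)
apply: bigmax_le => [|v _]; first by rewrite mulr_ge0 ?sqrtr_ge0.
by rewrite ffunE; exact: Qle.
Qed.
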